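(* Let $G=(V,E)$ be an undirected graph, let $i\in V$, and let $j\in\mathcal N(i)$ be the selected reference neighbor of $i$. When the neighborhood $\mathcal N(i)$ of $i$ in $G$ constitutes an independent set and the $X$-basis measurement at vertex $i$ of the graph state $|G\rangle$ yields $|+x\rangle$, the recovery operation simplifies to $$(U_+^{(i,j)})^{-1}=H_j .$$
   Context: For an undirected graph $G=(V,E)$, the graph state on qubits indexed by $V$ is $|G\rangle=\prod_{(a,b)\in E}\mathrm{CZ}_{a,b}\,|+\rangle^{\otimes|V|}$, where $\mathrm{CZ}$ is the controlled-$Z$ gate and $|\pm\rangle=(|0\rangle\pm|1\rangle)/\sqrt2$; also $|\pm x\rangle=|\pm\rangle$. $\mathcal N(v)$ is the set of neighbors of $v$ in $G$. $Z$ is the Pauli-$Z$ operator, $H$ is the Hadamard gate, $R_y(\theta)=\exp(-i\theta\sigma_y/2)$ (here $i$ in the exponent is the imaginary unit), and a subscript indicates the qubit acted on. Local complementation at a vertex $v$ is the map $\mathrm{LC}_v:(V,E)\mapsto(V,E\,\triangle\,\{(u,w): u,w\in\mathcal N(v),\,u\ne w\})$, with $\triangle$ the symmetric difference and $\mathcal N(v)$ taken in the graph to which the map is applied. Measuring qubit $i$ of $|G\rangle$ in the $X$-basis, with selected reference neighbor $j\in\mathcal N(i)$, is described by $$M_x^{(i)}|G\rangle=\tfrac1{\sqrt2}\left(|+x\rangle_i\otimes U_+^{(i,j)}|G''_{-i}\rangle+|-x\rangle_i\otimes U_-^{(i,j)}|G''_{-i}\rangle\right),$$ where $|G''_{-i}\rangle$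 is the graph state of the graph obtained from $\mathrm{LC}_j(\mathrm{LC}_i(\mathrm{LC}_j(G)))$ by removing vertex $i$, and the measurement-induced corrections are $$U_\pm^{(i,j)}=R_y(\mp\pi/2)_j\otimes\bigotimes_{u\in S_\pm}Z_u,$$ with $S_+=\mathcal N(i)\setminus(\mathcal N(j)\cup\{j\})$ and $S_-=\mathcal N(j)\setminus(\mathcal N(i)\cup\{i\})$. The recovery operation for outcome $|\pm x\rangle$ is the inverse correction operator $(U_\pm^{(i,j)})^{-1}$, applied to the post-measurement state $U_\pm^{(i,j)}|G''_{-i}\rangle$ of the remaining qubits in order to return to the graph state $|G''_{-i}\rangle$.
   Formalization: The identity (U_+)^{-1} = H_j is false as an operator equality (for one edge, R_y(π/2) ≠ H); it is stated as equality of the two actions on the post-measurement state for outcome |+x>, where H_j returns the graph state |G''_{-i}>. *)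

(* Defs.v *)
From HB Require Import structures.
From mathcomp Require Import all_boot all_order all_algebra.
From mathcomp Require Import complex.
From mathcomp Require Import all_classical all_reals all_analysis.
Import Order.TTheory GRing.Theory Num.Theory.
Import numFieldNormedType.Exports.

Set Implicit Arguments.
Unset Strict Implicit.
Unset Printing Implicit Defensive.

Local Open Scope complex_scope.
Local Open Scope ring_scope.

(* A graph on V is its set of edges, an edge being the unordered pair of its
   (distinct) endpoints. *)
Section Graphs.
Variable V : finType.
Implicit Types (E : {set {set V}}) (A : {set V}) (v : V).

Definition is_graph E := [forall e in E, #|e| == 2%N].

Definition neighbors E v : {set V} := [set u | [set v; u] \in E].

Definition independent E A := [forall u in A, forall w in A, [set u; w] \notin E].

Definition symdiff (T : finType) (A B : {set T}) : {set T} :=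
  (A :\: B) :|: (B :\: A).

Definition local_complement v E : {set {set V}} :=
  symdiff E
    [set [set u; w] | u in neighbors E v, w in neighbors E v & u != w].

Definition remove_vertex v E : {set {set {u | u != v}}} :=
  [set e : {set {u | u != v}} | val @: e \in E].

End Graphs.

Notation rest v := {u | u != v}.

(* The series converges entrywise for the topology of 'M[K]_n.+1. *)
Definition expmx (K : numFieldType) (n : nat) (A : 'M[K]_n.+1) : 'M[K]_n.+1 :=
  limn (series (fun k : nat => (k`!%:R : K)^-1 *: A ^+ k)).

Section Qubits.
Variable R : realType.
Local Notation C := R[i].

Definition mx2 (a b c d : C) : 'M[C]_2 :=
  \matrix_(r, s) if r == 0 then (if s == 0 then a else b)
                 else (if s == 0 then c else d).

Definition invsqrt2 : C := ((Num.sqrt 2)^-1 : R)%:C.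

Definition pauli_y : 'M[C]_2 := mx2 0 (- 'i) 'i 0.
Definition pauli_z : 'M[C]_2 := mx2 1 0 0 (-1).
Definition hadamard : 'M[C]_2 := invsqrt2 *: mx2 1 1 1 (-1).
Definition rot_y (theta : R) : 'M[C]_2 :=
  expmx ((- 'i * (theta / 2)%:C) *: pauli_y).

Definition ket_plus : 'cV[C]_2 := \col_(b < 2) invsqrt2.

Local Notation basis V := {ffun V -> 'I_2}.

(* States of the qubits indexed by V, given by their amplitudes in the
   computational basis. *)
Definition state (V : finType) := {ffun basis V -> C^o}.
HB.instance Definition _ V := Vector.on (state V).

Section Operators.
Variable V : finType.

Definition apply_kernel (K : basis V -> basis V -> C)
    (psi : state V) : state V :=
  [ffun x : basis V => \sum_y K x y * psi y].

Lemma apply_kernel_is_linear K : linear (apply_kernel K).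
Proof.
move=> a f g; apply/ffunP => x; rewrite !ffunE scaler_sumr -big_split /=.
apply: eq_bigr => y _; rewrite !ffunE mulrDr; congr (_ + _).
exact: mulrCA.
Qed.

HB.instance Definition _ K :=
  GRing.isLinear.Build C (state V) (state V) _ (apply_kernel K)
    (apply_kernel_is_linear K).

Definition kernel_op K : 'End(state V) := linfun (apply_kernel K).

Definition tensor_state (k : V -> 'cV[C]_2) : state V :=
  [ffun x : basis V => \prod_v k v (x v) 0].

Definition tensor_op (A : V -> 'M[C]_2) : 'End(state V) :=
  kernel_op (fun x y => \prod_v A v (x v) (y v)).

(* For e = {a, b}, this is CZ_{a,b} : |x> |-> (-1)^(x_a x_b) |x>. *)
Definition CZ (e : {set V}) : 'End(state V) :=
  kernel_op (fun x y => if x == y then (-1) ^+ (\prod_(a in e) x a)%N else 0).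

Definition graph_state (E : {set {set V}}) : state V :=
  (\big[@comp_lfun C (state V) (state V) (state V) / \1%VF]_(e in E) CZ e)
    (tensor_state (fun=> ket_plus)).

Definition insert_qubit (i : V) (b : 'I_2) (y : basis (rest i)) :
    basis V :=
  [ffun v => if insub v is Some u then y u else b].

(* (<k|_i (x) Id) psi *)
Definition partial_bra (i : V) (k : 'cV[C]_2) (psi : state V) : state (rest i) :=
  [ffun y : basis (rest i) => \sum_b (k b 0)^* * psi (insert_qubit b y)].

Definition normalize (psi : state V) : state V :=
  (sqrtC (\sum_x `|psi x| ^+ 2))^-1 *: psi.

End Operators.

Section XMeasurement.
Variables (V : finType) (E : {set {set V}}) (i j : V).

(* State of the other qubits after an X-basis measurement of qubit i of |G>
   with outcome |+x>. *)
Definition post_measurement_plus : state (rest i) :=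
  normalize (partial_bra i ket_plus (graph_state E)).

(* |G''_{-i}>, for G'' = LC_j (LC_i (LC_j G)) *)
Definition target_state : state (rest i) :=
  graph_state (remove_vertex i
    (local_complement j (local_complement i (local_complement j E)))).

(* A_j on the qubits other than i; meaningful for j != i only. *)
Definition gate_at (A : 'M[C]_2) : 'End(state (rest i)) :=
  tensor_op (fun u : rest i => if val u == j then A else 1%:M).

Definition S_plus : {set V} := neighbors E i :\: (neighbors E j :|: [set j]).

(* U_+^(i,j), with the identity on the qubits outside S_+ and j.  It is
   bijective, so ^-1%VF is its two-sided inverse. *)
Definition correction_plus : 'End(state (rest i)) :=
  tensor_op (fun u : rest i =>
    if val u == j then rot_y (- (pi / 2))
    else if val u \in S_plus then pauli_z else 1%:M).

End XMeasurement.
End Qubits.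

(* Main.v *)
(* Write x for a 0/1 labelling of the vertices and q(x) for the number mod 2 of
   edges whose two ends are labelled 1, so that |G> has amplitudes
   2^(-n/2) (-1)^q(x).  Put A = N(i) \ j, B = N(j) \ i (disjoint, as N(i) is
   independent), and write A(x), B(x) for the parities of x on A and B.

   Projecting qubit i on <+| sums over x_i the sign (-1)^(x_i (x_j + A(x))), so
   the outcome is, up to normalization, (-1)^q(x) restricted to x_j = A(x), where
   q(x) = q0(x) + x_j B(x) and q0 omits the edges at i and j.  Applying H_j to it
   yields the phase q0(x) + A(x) B(x) + x_j A(x).  This is the phase of G'' - i:
   the three local complementations toggle the cliques on i + B, on j + A + B
   and on i + A, and a clique on a disjoint union S + T has phase
   q_S + q_T + S(x) T(x).

   On the other side R_y(-pi/2) = Z H, so U_+ is H_j followed by Z on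
   j + A = N(i), and this Z-string is trivial on the support x_j = A(x). *)
Require Import Defs.
From mathcomp Require Import all_boot all_order all_algebra.
From mathcomp Require Import complex.
From mathcomp Require Import all_classical all_reals all_analysis.
From mathcomp Require Import ring lra.
Import Order.TTheory GRing.Theory Num.Theory.
Import numFieldNormedType.Exports.

Set Implicit Arguments.
Unset Strict Implicit.
Unset Printing Implicit Defensive.

Local Open Scope complex_scope.
Local Open Scope ring_scope.

(** * The rotation $R_y$ as an explicit matrix, and its value at $-\pi/2$ *)

Section RotY.
Variable R : realType.
Local Notation C := R[i].
Local Notation K := (R[i] : numFieldType).

Lemma cvg_real_complex (u : nat -> R) (l : R) :
  (u @ \oo --> l)%classic -> ((fun n => (u n)%:C : K) @ \oo --> (l%:C : K))%classic.
Proof.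
move=> /cvgrPdist_lt ul; apply/cvgrPdist_lt => -[e e'].
(* In the partial order of [R[i]] a positive radius is real, so the estimate reduces to the real
   one. *)
rewrite ltcE /= => /andP[/eqP -> e0].
apply: filterS (ul _ e0) => n; rewrite -rmorphB normc_def /= expr0n addr0.
by rewrite sqrtr_sqr ltcR.
Qed.

(** There are finitely many entries, so the eventual bounds on each of them hold simultaneously. *)
Lemma cvg_mx (K : numFieldType) (m n : nat) (u : nat -> 'M[K]_(m, n))
    (l : 'M[K]_(m, n)) :
  (forall i j, ((fun k => u k i j) @ \oo --> l i j)%classic) ->
  (u @ \oo --> l)%classic.
Proof.
move=> ul; apply/cvg_ballP => e e0.
have : (\forall k \near \oo, forall ij : 'I_m * 'I_n,
    ball (l ij.1 ij.2) e (u k ij.1 ij.2))%classic.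
  by apply: filter_forall => -[i j] /=; move/cvg_ballP: (ul i j); apply.
by apply: filterS => k H; split=> // i j; exact: (H (i, j)).
Qed.

Lemma expmx_entrywise (K : numFieldType) (n : nat) (A L : 'M[K]_n.+1) :
  (forall i j, ((fun N => \sum_(0 <= k < N) (k`!%:R^-1 *: A ^+ k) i j) @ \oo -->
     L i j)%classic) ->
  expmx A = L.
Proof.
move=> AL; rewrite /expmx; apply: cvg_lim; first exact: norm_hausdorff.
apply: cvg_mx => i j.
by under [X in (X @ \oo)%classic]eq_fun do rewrite summxE; exact: AL.
Qed.

Lemma mx2M (a b c d a' b' c' d' : C) :
  mx2 a b c d *m mx2 a' b' c' d' =
  mx2 (a * a' + b * c') (a * b' + b * d') (c * a' + d * c') (c * b' + d * d').
Proof.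
by apply/matrixP => r s; rewrite !mxE !big_ord_recl big_ord0 !mxE /= addr0;
   case: (r == 0); case: (s == 0).
Qed.

Lemma scale_mx2 (k a b c d : C) :
  k *: mx2 a b c d = mx2 (k * a) (k * b) (k * c) (k * d).
Proof.
by apply/matrixP => r s; rewrite !mxE; case: (r == 0); case: (s == 0).
Qed.

(** The generator squares to $-t^2$, so its powers alternate between diagonal and antidiagonal, and
    the terms of the exponential series are those of cosine and sine. *)
Lemma rotation_generator_exp (t : R) (k : nat) :
  (k`!%:R)^-1 *: mx2 0 (- t%:C) t%:C 0 ^+ k =
  mx2 (cos_coeff t k)%:C (- sin_coeff t k)%:C
      (sin_coeff t k)%:C (cos_coeff t k)%:C.
Proof.
pose c k : R := (~~ odd k)%:R * (-1) ^+ k./2 * t ^+ k.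
pose s k : R := (odd k)%:R * (-1) ^+ k.-1./2 * t ^+ k.
have -> : mx2 0 (- t%:C) t%:C 0 ^+ k = mx2 (c k)%:C (- s k)%:C (s k)%:C (c k)%:C.
  elim: k => [|k IHk].
    rewrite expr0 /c /s /= !mul1r !mul0r oppr0; apply/matrixP => r q.
    by rewrite !mxE; case: r q => [[|[|?]] ?] [[|[|?]] ?].
  rewrite exprSr IHk -mulmxE mx2M /c /s /=.
  (* One more factor sends $(c_k, s_k)$ to $(-t s_k, t c_k)$; the parity of $k$ decides which of the
     two vanishes and how the halved exponent of $-1$ moves. *)
  have [ok|ek] := boolP (odd k) => /=.
    have k2 : k./2.+1 = uphalf k by rewrite uphalf_half ok.
    have k1 : k.-1./2 = k./2 by case: (k) ok => //= k' /negbTE e; rewrite uphalf_half e.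
    rewrite -k2 k1 !exprS.
    by congr mx2; ring.
  rewrite uphalf_half (negbTE ek) add0n !exprS.
  by congr mx2; ring.
have kC : (k`!%:R : C)^-1 = ((k`!%:R)^-1 : R)%:C by rewrite fmorphV rmorph_nat.
rewrite scale_mx2 kC /c /s /cos_coeff /sin_coeff /=.
by congr mx2; rewrite -?mulrN; ring.
Qed.

Lemma rot_yE (theta : R) :
  rot_y theta = mx2 (cos (theta / 2))%:C (- sin (theta / 2))%:C
                    (sin (theta / 2))%:C (cos (theta / 2))%:C.
Proof.
rewrite /rot_y /pauli_y; set t := theta / 2.
(* The factor $-i$ cancels the imaginary entries of $\sigma_y$ and leaves a real generator. *)
have -> : (- 'i * t%:C) *: mx2 0 (- 'i) 'i 0 = mx2 0 (- t%:C) t%:C 0 :> 'M[C]_2.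
  rewrite scale_mx2 !mulr0.
  have ii : 'i * 'i = -1 :> C by rewrite -expr2 sqrCi.
  by congr mx2; ring: ii.
apply: (@expmx_entrywise K 1) => r q.
have Re_series (f : nat -> R) n :
    \sum_(0 <= k < n) (f k)%:C = (\sum_(0 <= k < n) f k)%:C :> C.
  by rewrite rmorph_sum.
have cosC : ((fun n => (series (cos_coeff t) n)%:C : K) @ \oo -->
    ((cos t)%:C : K))%classic.
  by apply: cvg_real_complex; rewrite cos.unlock; exact: is_cvg_series_cos_coeff.
have sinC : ((fun n => (series (sin_coeff t) n)%:C : K) @ \oo -->
    ((sin t)%:C : K))%classic.
  by apply: cvg_real_complex; rewrite sin.unlock; exact: is_cvg_series_sin_coeff.
have nsinC : ((fun n => (- series (sin_coeff t) n)%:C : K) @ \oo -->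
    ((- sin t)%:C : K))%classic.
  apply: cvg_real_complex; apply: cvgN; rewrite sin.unlock.
  exact: is_cvg_series_sin_coeff.
rewrite [X in (X @ \oo)%classic](_ : _ = fun n =>
    mx2 (series (cos_coeff t) n)%:C (- series (sin_coeff t) n)%:C
        (series (sin_coeff t) n)%:C (series (cos_coeff t) n)%:C r q); last first.
  apply/funext => n; rewrite /series /= mxE.
  rewrite -sumrN -!Re_series.
  under eq_bigr do rewrite rotation_generator_exp mxE.
  by case: (r == 0); case: (q == 0).
rewrite mxE; under [X in (X @ \oo)%classic]eq_fun do rewrite mxE.
case: (r == 0); case: (q == 0); [exact: cosC | | exact: sinC | exact: cosC].
exact: nsinC.
Qed.

Lemma invsqrt2_sqr : invsqrt2 R * invsqrt2 R = 2^-1.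
Proof.
by rewrite /invsqrt2 -rmorphM -invfM -expr2 sqr_sqrtr // fmorphV rmorph_nat.
Qed.

(** Doubling the angle turns $\cos(\pi/2) = 0$ into $\cos^2(\pi/4) = 1/2$; positivity picks the
    root. *)
Lemma cos_piquarter : cos (pi / 4) = (Num.sqrt 2)^-1 :> R.
Proof.
have c0 : 0 < cos (pi / 4 : R).
  apply: cos_gt0_pihalf; have := pi_gt0 R; lra.
have c2 : cos (pi / 4 : R) ^+ 2 = 2^-1.
  have := cos2Dsin2 (pi / 4 : R); have := @cos_pihalf R.
  rewrite [pi / 2](_ : _ = pi / 4 + pi / 4 :> R); last by field.
  rewrite cosD -!expr2; lra.
by rewrite -sqrtrV // -c2 sqrtr_sqr gtr0_norm.
Qed.

Lemma rot_y_minus_pihalf :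
  rot_y (- (pi / 2)) = mx2 (invsqrt2 R) (invsqrt2 R) (- invsqrt2 R) (invsqrt2 R).
Proof.
have s4 : sin (pi / 4) = (Num.sqrt 2)^-1 :> R.
  by rewrite -cos_piquarter -cosBpihalf -cosN; congr cos; field.
rewrite rot_yE (_ : - (pi / 2) / 2 = - (pi / 4)); last by field.
by rewrite sinN cosN opprK s4 cos_piquarter rmorphN.
Qed.

End RotY.
(* Imported again because classical_sets shadows the set lemmas of finset. *)
From mathcomp Require Import fintype finset.

(** * Graph phases over $\mathbb F_2$ and their change under local complementation *)

Section GraphPhase.
Variable V : finType.
Implicit Types (E : {set {set V}}) (A B : {set V}) (x : V -> bool) (v : V).

(** The exponent $q(x)$ in the amplitudes, with [addb] as addition mod 2. *)
Definition phase E x := \big[addb/false]_(e in E) [forall a in e, x a].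

Definition parity A x := \big[addb/false]_(a in A) x a.

(** Spelled exactly as the toggled set in [local_complement], so that the two agree by
    conversion. *)
Definition clique A : {set {set V}} :=
  [set [set u; w] | u in A, w in A & u != w].

Lemma local_complementE v E :
  local_complement v E = symdiff E (clique (neighbors E v)).
Proof. by []. Qed.

Lemma in_symdiff (T : finType) (A B : {set T}) t :
  (t \in symdiff A B) = (t \in A) (+) (t \in B).
Proof. by rewrite !inE; case: (t \in A); case: (t \in B). Qed.

Lemma in_neighbors E v u : (u \in neighbors E v) = ([set v; u] \in E).
Proof. by rewrite inE. Qed.

Lemma neighbors_symdiff E E' v :
  neighbors (symdiff E E') v = symdiff (neighbors E v) (neighbors E' v).
Proof. by apply/setP => u; rewrite in_symdiff !in_neighbors in_symdiff. Qed.

Lemma in_clique A (e : {set V}) :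
  (e \in clique A) = (e \subset A) && (#|e| == 2%N).
Proof.
apply/idP/andP => [/imset2P[u w uA /[!inE] /andP[wA uw] ->]|
    [eA /cards2P[u [w [uw eE]]]]].
  by rewrite cards2 uw; split=> //; apply/subsetP => z /set2P[] ->.
move: eA; rewrite eE subUset !sub1set => /andP[uA wA].
by apply/imset2P; exists u w => //; rewrite inE wA.
Qed.

Lemma neighbors_clique A v :
  neighbors (clique A) v = if v \in A then A :\ v else set0.
Proof.
apply/setP => u; rewrite in_neighbors in_clique subUset !sub1set cards2.
by case: ifP => vA; rewrite !inE //= [v == u]eq_sym andbC; case: (u == v).
Qed.

Lemma is_graph_clique A : is_graph (clique A).
Proof. by apply/forall_inP => e; rewrite in_clique => /andP[]. Qed.

Lemma neighbors_sym E u v : (u \in neighbors E v) = (v \in neighbors E u).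
Proof. by rewrite !in_neighbors setUC. Qed.

Lemma neighbors_irrefl E v : is_graph E -> v \notin neighbors E v.
Proof.
move=> /forall_inP gE; rewrite in_neighbors setUid.
by apply/negP => /gE; rewrite cards1.
Qed.

(** Edges common to both graphs are counted twice and cancel mod 2. *)
Lemma phase_symdiff E E' x :
  phase (symdiff E E') x = phase E x (+) phase E' x.
Proof.
rewrite /phase [LHS]big_mkcond [X in X (+) _]big_mkcond [X in _ (+) X]big_mkcond.
rewrite -big_split; apply: eq_bigr => e _; rewrite in_symdiff.
by do 2!case: (_ \in _); rewrite /= ?addbb ?addbF.
Qed.

Lemma parityU A B x : [disjoint A & B] ->
  parity (A :|: B) x = parity A x (+) parity B x.
Proof.
move=> dAB; rewrite /parity -bigU //.
by apply: eq_bigl => a; rewrite inE.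
Qed.

Lemma parityU1 A x v : v \notin A -> parity (v |: A) x = x v (+) parity A x.
Proof. by move=> vA; rewrite /parity big_setU1. Qed.

(** The edges at [v] are the pairs $\{v,u\}$ with $u \in N(v)$, each contributing $x_v x_u$; so the
    phase is affine in $x_v$ with slope the parity on $N(v)$. *)
Lemma phase_split E x v : is_graph E ->
  phase E x = phase [set e in E | v \notin e] x (+) (x v && parity (neighbors E v) x).
Proof.
move=> gE; rewrite /phase (bigID (fun e : {set V} => v \notin e)) /=; congr (_ (+) _).
  by apply: eq_bigl => e; rewrite [RHS]inE.
have vN := neighbors_irrefl v gE.
rewrite /parity big_distrr /=.
transitivity (\big[addb/false]_(e in [set [set v; u] | u in neighbors E v])
    [forall a in e, x a]).
  apply: eq_bigl => e; rewrite negbK; apply/andP/imsetP => [[eE ve]|[u uN ->]].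
    have /cards2P[a [b [ab eab]]] := forall_inP gE _ eE.
    move: ve; rewrite eab => /set2P[] ->.
      by exists b; rewrite // in_neighbors -eab.
    by exists a; rewrite ?in_neighbors setUC -?eab.
  by rewrite set21 -in_neighbors.
rewrite big_imset /=; last first.
  (* The pair $\{v,u\}$ determines $u$ because $v \notin N(v)$. *)
  move=> u w uN wN /setP/(_ u); rewrite set22 => /esym /set2P[uv|//].
  by rewrite -{1}uv uN in vN.
apply: eq_bigr => u _; apply/forall_inP/andP => [H|[xv xu] a /set2P[] -> //].
by split; apply: H; rewrite ?set21 ?set22.
Qed.

Lemma eq_phase_off E x y v : (forall u, u != v -> x u = y u) ->
  phase [set e in E | v \notin e] x = phase [set e in E | v \notin e] y.
Proof.
move=> xy; apply: eq_bigr => e; rewrite inE => /andP[_ ve].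
apply: eq_forallb_in => a ae; apply: xy.
by apply: contraNneq ve => <-.
Qed.

Lemma phase_cliqueU1 A x v : v \notin A ->
  phase (clique (v |: A)) x = phase (clique A) x (+) (x v && parity A x).
Proof.
move=> vA; rewrite (phase_split _ v (is_graph_clique _)).
rewrite neighbors_clique setU11 setU1K //; congr (phase _ x (+) _).
apply/setP => e; rewrite inE !in_clique.
apply/idP/idP => [/andP[/andP[eA ->] ve]|/andP[eA ->]].
  rewrite andbT; apply/subsetP => a ae.
  by have /setU1P[av|//] := subsetP eA a ae; rewrite -av ae in ve.
rewrite (subset_trans eA (subsetUr _ _)) /=.
by apply: contra vA => /(subsetP eA).
Qed.

(** The cross edges form a complete bipartite graph, whose phase is the product of the two parities.
    The induction on $|A|$ splits off one vertex of $A$ at a time. *)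
Lemma phase_cliqueU A B x : [disjoint A & B] ->
  phase (clique (A :|: B)) x =
  phase (clique A) x (+) phase (clique B) x (+) (parity A x && parity B x).
Proof.
have [n] := ubnP #|A|; elim: n A => // n IHn A; rewrite ltnS => An dAB.
have [->|[a aA]] := set_0Vmem A.
  have -> : phase (clique set0) x = false.
    apply: big1 => e; rewrite in_clique subset0 => /andP[/eqP ->].
    by rewrite cards0.
  by rewrite set0U /parity big_set0 addbF addFb.
have aB : a \notin B by rewrite (disjointFr dAB aA).
have dAB' : [disjoint A :\ a & B] by apply: disjointWl dAB; exact: subD1set.
rewrite -(setD1K aA) -setUA !phase_cliqueU1 ?setD11 //; last first.
  by rewrite inE setD11.
rewrite IHn //; last by rewrite (leq_trans _ An) // [X in (_ < X)%N](cardsD1 a) aA.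
rewrite parityU // parityU1 ?setD11 //.
case: (x a); case: (parity _ x); case: (parity B x); case: (phase _ x);
  by case: (phase _ x).
Qed.

(** Taking $x_i = 0$ anticipates the deletion of $i$: its membership in two of the toggled cliques
    then contributes nothing. *)
Lemma phase_pivot E i j x : is_graph E -> j \in neighbors E i ->
    independent E (neighbors E i) -> x i = false ->
  phase (local_complement j (local_complement i (local_complement j E))) x =
  phase [set e in E | j \notin e] x (+)
  (parity (neighbors E i :\ j) x && parity (neighbors E j) x) (+)
  (x j && parity (neighbors E i :\ j) x).
Proof.
move=> gE jNi indNi xi.
have iNj : i \in neighbors E j by rewrite neighbors_sym.
have jNj := neighbors_irrefl j gE; have iNi := neighbors_irrefl i gE.
have ji : j != i by apply: contraNneq iNi => ji; rewrite -{1}ji.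
set A := neighbors E i :\ j; set B := neighbors E j :\ i.
have NiE : neighbors E i = j |: A by rewrite setD1K.
have NjE : neighbors E j = i |: B by rewrite setD1K.
have iA : i \notin A by rewrite inE (negbTE iNi) andbF.
have jA : j \notin A by rewrite setD11.
have iB : i \notin B by rewrite setD11.
have jB : j \notin B by rewrite inE (negbTE jNj) andbF.
(* A common element $u$ would give an edge $\{j,u\}$ inside the independent set $N(i)$. *)
have dAB : [disjoint A & B].
  apply/pred0Pn => -[u /andP[/= uA uB]].
  have uNi : u \in neighbors E i by move: uA; rewrite inE => /andP[].
  have : u \in neighbors E j by move: uB; rewrite inE => /andP[].
  by rewrite in_neighbors (negbTE (forall_inP (forall_inP indNi _ jNi) _ uNi)).
set E1 := local_complement j E; set E2 := local_complement i E1.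
(* The clique toggled on $N(j) = i + B$ joins $i$ to all of $B$. *)
have N1i : neighbors E1 i = j |: (A :|: B).
  rewrite neighbors_symdiff -/(clique _) neighbors_clique iNj NiE.
  apply/setP => u; rewrite -/B in_symdiff !in_setU1 in_setU.
  have [->|_] := eqVneq u j; first by rewrite (negbTE jB).
  case uA: (u \in A) => //=.
  by rewrite (disjointFr dAB uA).
(* Complementing at $j$ leaves $N(j) = i + B$ unchanged; complementing at $i$ then toggles $A + B$
   in it, which exchanges $B$ for $A$. *)
have N2j : neighbors E2 j = i |: A.
  rewrite neighbors_symdiff -/(clique _) N1i neighbors_clique setU11.
  rewrite neighbors_symdiff -/(clique _) neighbors_clique (negbTE jNj) NjE.
  apply/setP => u.
  rewrite !in_symdiff !in_setU1 [u \in (j |: _) :\ j]in_setD1 in_setU1.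
  rewrite in_setU !in_set0 addbF.
  have [->|ui] := eqVneq u i; last first.
    have [->|uj] := eqVneq u j; first by rewrite (negbTE jA) (negbTE jB).
    case uA: (u \in A) => /=; last by rewrite addbb.
    by rewrite (disjointFr dAB uA).
  by rewrite ?eqxx eq_sym (negbTE ji) (negbTE iA) (negbTE iB) ?addbF.
rewrite [local_complement j E2]local_complementE phase_symdiff N2j.
rewrite {1}/E2 local_complementE phase_symdiff N1i.
rewrite /E1 local_complementE phase_symdiff NjE.
rewrite (phase_cliqueU1 _ iB) (phase_cliqueU1 _ iA) xi !addbF.
have jAB : j \notin A :|: B by rewrite in_setU negb_or jA.
rewrite (phase_cliqueU1 _ jAB) phase_cliqueU // parityU //.
rewrite (phase_split x j gE) NjE parityU1 // xi addFb.
(* The phases of the cliques on $A$ and on $B$ each occur twice and cancel. So does $x_j B(x)$,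
   which comes once from the edges at $j$ and once from the clique on $j + A + B$. *)
case: (x j); case: (parity A x); case: (parity B x); case: (phase _ x);
  case: (phase _ x); by case: (phase _ x).
Qed.

End GraphPhase.

(** * Deleting a vertex amounts to labelling it 0 *)

Section RemoveVertex.
Variables (V : finType) (i : V).

Definition extend_false (y : rest i -> bool) (v : V) : bool :=
  if insub v is Some u then y u else false.

Lemma extend_false_val y u : extend_false y (val u) = y u.
Proof. by rewrite /extend_false valK. Qed.

Lemma extend_falseE y : extend_false y i = false.
Proof. by rewrite /extend_false insubF // eqxx. Qed.

(** An edge at [i] has an end labelled [false] and contributes nothing; the other edges are the
    images under [val] of the edges of the smaller graph. *)
Lemma phase_remove_vertex (E : {set {set V}}) y :
  phase (remove_vertex i E) y = phase E (extend_false y).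
Proof.
rewrite [RHS](bigID (fun e : {set V} => i \in e)) /= big1 ?addFb; last first.
  move=> e /andP[_ ie]; apply/negbTE/forall_inPn; exists i => //.
  by rewrite extend_falseE.
transitivity (\big[addb/false]_(e in
    [set val @: (f : {set rest i}) | f in remove_vertex i E])
      [forall a in e, extend_false y a]); last first.
  apply: eq_bigl => e; apply/imsetP/andP => [[f]|[eE ie]].
    rewrite inE => fE ->; split=> //; apply/imsetP => -[[u /= ui] _ iu].
    by rewrite -iu eqxx in ui.
  have ef : e = val @: [set u : rest i | val u \in e].
    apply/setP => v; apply/idP/imsetP => [ve|[u /[!inE] ue -> //]].
    have vi : v != i by apply: contraNneq ie => <-.
    by exists (exist _ v vi); rewrite ?inE.
  by exists [set u : rest i | val u \in e]; rewrite // inE -ef.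
rewrite big_imset /=; last by move=> f g _ _; apply: imset_inj; exact: val_inj.
apply: eq_bigr => f _; apply/forall_inP/forall_inP => [H _ /imsetP[u uf ->]|H u uf].
  by rewrite extend_false_val; exact: H.
by rewrite -extend_false_val; apply: H; apply: imset_f.
Qed.

Lemma parity_extend_false (A : {set V}) y :
  parity A (extend_false y) = \big[addb/false]_(u | val u \in A) y u.
Proof.
rewrite /parity (bigID (pred1 i)) /= big1 ?addFb; last first.
  by move=> v /andP[_ /eqP ->]; rewrite extend_falseE.
transitivity (\big[addb/false]_(v in [set val u | u : rest i in [set u | val u \in A]])
    extend_false y v).
  apply: eq_bigl => v; apply/andP/imsetP => [[vA vi]|[u /[!inE] uA ->]].
    by exists (exist _ v vi); rewrite ?inE.
  by split=> //; exact: (valP u).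
rewrite big_imset /=; last by move=> u w _ _; exact: val_inj.
by apply: eq_big => [u|u _]; rewrite ?inE ?extend_false_val.
Qed.

End RemoveVertex.

(** * Amplitudes of graph states and the calculus of tensor product operators *)

Section Amplitudes.
Variables (R : realType) (V : finType).
Local Notation C := R[i].
Local Notation basis V := {ffun V -> 'I_2}.
Implicit Types (E : {set {set V}}) (x y : basis V) (psi : state R V).

Definition bits x : V -> bool := fun v => x v != 0.

Definition upd x (v : V) (b : 'I_2) : basis V :=
  [ffun u => if u == v then b else x u].

Lemma kernel_opE (K : basis V -> basis V -> C) psi x :
  kernel_op K psi x = \sum_y K x y * psi y.
Proof. by rewrite lfunE /= ffunE. Qed.

Lemma CZE (e : {set V}) psi x :
  CZ R e psi x = (-1) ^+ [forall a in e, bits x a] * psi x.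
Proof.
rewrite kernel_opE (bigD1 x) //= eqxx [X in _ + X]big1 ?addr0; last first.
  by move=> y yx; rewrite eq_sym (negbTE yx) mul0r.
(* A product of labels in $\{0,1\}$ is the conjunction of the corresponding bits. *)
congr (_ ^+ _ * _); case: forall_inP => [H|/forall_inP/forall_inPn[a ae]].
  rewrite big1 // => a /H; rewrite /bits.
  by case: (x a) => [[|[|?]] ?].
by rewrite negbK => /eqP xa; rewrite (bigD1 a) //= xa.
Qed.

Lemma graph_stateE E x :
  graph_state R E x = invsqrt2 R ^+ #|V| * (-1) ^+ phase E (bits x).
Proof.
rewrite /graph_state /phase; set psi := tensor_state _.
have -> : invsqrt2 R ^+ #|V| = psi x.
  rewrite ffunE; under eq_bigr do rewrite mxE.
  by rewrite prodr_const.
rewrite mulrC; elim: (index_enum _) => [|e s IHs].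
  by rewrite !big_nil id_lfunE mul1r.
rewrite !big_cons; case: (e \in E) => //.
by rewrite comp_lfunE CZE IHs signr_addb mulrA.
Qed.

Lemma tensor_opE (A : V -> 'M[C]_2) psi x :
  tensor_op A psi x = \sum_(y : basis V) (\prod_v A v (x v) (y v)) * psi y.
Proof. exact: kernel_opE. Qed.

(** A kernel entry vanishes unless $y$ agrees with $x$ off [v0], so each value $b$ at [v0] leaves
    the single term $y =$ [upd x v0 b]. *)
Lemma tensor_op_diag_off (A : V -> 'M[C]_2) (v0 : V) psi x :
    (forall v, v != v0 -> is_diag_mx (A v)) ->
  tensor_op A psi x =
  (\prod_(v | v != v0) A v (x v) (x v)) *
  \sum_b A v0 (x v0) b * psi (upd x v0 b).
Proof.
move=> diagA; rewrite tensor_opE (partition_big (fun y : basis V => y v0) xpredT) //=.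
rewrite big_distrr; apply: eq_bigr => b _ /=.
rewrite (bigD1 (upd x v0 b)) /= ?ffunE ?eqxx // [X in _ + X]big1 ?addr0.
  rewrite (bigD1 v0) //= ffunE eqxx mulrA [X in X * _]mulrC; congr (_ * _ * _).
  by apply: eq_bigr => v vv0; rewrite ffunE (negbTE vv0).
move=> y /andP[/eqP yb yx].
have [v /andP[vv0 xyv]] : exists v, (v != v0) && (x v != y v).
  apply/existsP; apply: contra_neqT yx => /existsPn H; apply/ffunP => v.
  rewrite ffunE; case: eqVneq => [->//|vv0].
  by have := H v; rewrite vv0 negbK => /eqP.
have /is_diag_mxP dA := diagA _ vv0.
by rewrite (bigD1 v) //= dA // !mul0r.
Qed.

Lemma tensor_op_comp (A B : V -> 'M[C]_2) psi :
  tensor_op A (tensor_op B psi) = tensor_op (fun v => A v *m B v) psi.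
Proof.
apply/ffunP => x; rewrite !tensor_opE.
under eq_bigr do rewrite tensor_opE big_distrr.
rewrite exchange_big; apply: eq_bigr => y _ /=.
under eq_bigr do rewrite mulrA -big_split.
(* Distributivity: the sum over all intermediate labellings factors into one matrix product per
   qubit. *)
rewrite -big_distrl -(bigA_distr_bigA (fun v b => A v (x v) b * B v b (y v))) /=.
by congr (_ * _); apply: eq_bigr => v _; rewrite mxE.
Qed.

Lemma tensor_op1 psi : tensor_op (fun=> 1%:M) psi = psi.
Proof.
apply/ffunP => x; rewrite tensor_opE (bigD1 x) //= big1 ?mul1r.
  rewrite big1 ?addr0 // => y yx.
  have [v xyv] : exists v, x v != y v.
    by apply/existsP; apply: contra_neqT yx => /existsPn H; apply/ffunP => v;
       apply/esym/eqP; rewrite -[_ == _]negbK.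
  by rewrite (bigD1 v) //= mxE (negbTE xyv) !mul0r.
by move=> v _; rewrite mxE eqxx.
Qed.

(** A trivial kernel is what lets [^-1%VF] cancel the operator; a left inverse of every factor
    supplies it. *)
Lemma tensor_op_lker0 (A B : V -> 'M[C]_2) :
  (forall v, B v *m A v = 1%:M) -> lker (tensor_op A) == 0%VS.
Proof.
move=> BA; apply/lker0P => f g /(congr1 (tensor_op B)); rewrite !tensor_op_comp.
have -> : (fun v => B v *m A v) = fun=> 1%:M by apply/funext.
by rewrite !tensor_op1.
Qed.

End Amplitudes.

(** * The post-measurement state, the Hadamard gate and the correction operator in amplitudes *)

Section XMeasurementAmplitudes.
Variables (R : realType) (V : finType) (E : {set {set V}}) (i j : V).
Hypotheses (graphE : is_graph E) (jNi : j \in neighbors E i)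
  (indNi : independent E (neighbors E i)).
Local Notation C := R[i].
Local Notation basis V := {ffun V -> 'I_2}.
Local Notation c := (invsqrt2 R).
Implicit Types (x y : basis (rest i)) (b : 'I_2).

Let jr_subproof : j != i.
Proof.
by have := neighbors_irrefl i graphE; apply: contraNneq => ji; rewrite -{1}ji.
Qed.

Let jr : rest i := exist _ j jr_subproof.
(** With $i$ labelled 0, [P], [a] and [s] are $q_0$, $A(x)$ and $B(x)$: the edges at $i$ drop out of
    [P], and $i \in N(j)$ does not affect [s]. *)
Let ext y := extend_false (bits y).
Let P y := phase [set e in E | j \notin e] (ext y).
Let a y := parity (neighbors E i :\ j) (ext y).
Let s y := parity (neighbors E j) (ext y).

Let ext_jr y : ext y j = (y jr != 0).
Proof. exact: (extend_false_val (bits y) jr). Qed.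

Let ext_upd y b v : v != j -> ext (upd y jr b) v = ext y v.
Proof.
move=> vj; rewrite /ext /extend_false; case: insubP => // u _ uv.
rewrite /bits ffunE; case: (eqVneq u jr) => // ujr.
by rewrite -uv ujr eqxx in vj.
Qed.

Let eq_parity (A : {set V}) y b : j \notin A ->
  parity A (ext (upd y jr b)) = parity A (ext y).
Proof.
move=> jA; apply: eq_bigr => v vA; apply: ext_upd.
by apply: contraNneq jA => <-.
Qed.

Let P_upd y b : P (upd y jr b) = P y.
Proof. by apply: eq_phase_off => v; exact: ext_upd. Qed.

Let a_upd y b : a (upd y jr b) = a y.
Proof. by apply: eq_parity; rewrite setD11. Qed.

Let s_upd y b : s (upd y jr b) = s y.
Proof. by apply: eq_parity; exact: neighbors_irrefl. Qed.

Lemma target_stateE y :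
  target_state R E i j y =
  c ^+ #|{: rest i}| * (-1) ^+ (P y (+) (a y && s y) (+) ((y jr != 0) && a y)).
Proof.
rewrite graph_stateE phase_remove_vertex phase_pivot ?extend_falseE //.
by rewrite -ext_jr.
Qed.

(** The coefficient of the inserted bit is the parity on $N(i)$, that is $x_j + A(x)$. *)
Lemma phase_insert b y :
  phase E (bits (insert_qubit b y)) =
  P y (+) ((y jr != 0) && s y) (+) ((b != 0) && ((y jr != 0) (+) a y)).
Proof.
have off v : v != i -> bits (insert_qubit b y) v = ext y v.
  by move=> vi; rewrite /bits /ext ffunE /extend_false insubT.
have at_i : bits (insert_qubit b y) i = (b != 0).
  by rewrite /bits ffunE insubF // eqxx.
rewrite (phase_split _ i graphE) at_i (eq_phase_off _ off).
have -> : phase [set e in E | i \notin e] (ext y) = phase E (ext y).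
  by rewrite [RHS](phase_split _ i graphE) /ext extend_falseE addbF.
rewrite (phase_split _ j graphE) ext_jr; congr (_ (+) (_ && _)).
transitivity (parity (neighbors E i) (ext y)).
  apply: eq_bigr => v vN; apply: off.
  by apply: contraTneq vN => ->; exact: neighbors_irrefl.
by rewrite -(setD1K jNi) parityU1 ?setD11 // ext_jr.
Qed.

(** The last factor is 2 on the support $x_j = A(x)$ and 0 off it. *)
Let amplitude y : C :=
  c ^+ #|{: rest i}|.+1 * (-1) ^+ (P y (+) ((y jr != 0) && s y)) *
  (1 + (-1) ^+ ((y jr != 0) (+) a y)).

Let c_ge0 : 0 <= c.
Proof. by rewrite /invsqrt2 ler0c invr_ge0 sqrtr_ge0. Qed.

Let c2 : c ^+ 2 = 2^-1. Proof. by rewrite expr2 invsqrt2_sqr. Qed.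

Let c_neq0 : c != 0.
Proof. by rewrite -sqrf_eq0 c2 invr_eq0 pnatr_eq0. Qed.

Lemma card_rest : #|V| = #|{: rest i}|.+1.
Proof. by rewrite card_sig -(cardC (pred1 i)) card1 add1n. Qed.

Lemma partial_bra_graph_state y :
  partial_bra i (ket_plus R) (graph_state R E) y = c * amplitude y.
Proof.
rewrite ffunE !big_ord_recl big_ord0 addr0 !graph_stateE !phase_insert !mxE /=.
rewrite addbF geC0_conj // card_rest /amplitude !signr_addb.
set q := c ^+ _; set p := (-1) ^+ P y * _; set e := (-1) ^+ (y jr != 0) * _.
by rewrite !mulrDr mulr1 !mulrA.
Qed.

Let flip y : basis (rest i) := upd y jr (if y jr == 0 then 1 else 0).

(** Flipping qubit $j$ reverses every sign, as $j \notin A$; hence the support is half of the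
    basis. *)
Let sum_sign : \sum_(y : basis (rest i)) (-1) ^+ ((y jr != 0) (+) a y) = 0 :> C.
Proof.
have flipK : involutive flip.
  move=> y; apply/ffunP => v; rewrite /flip !ffunE eqxx.
  by have [->|//] := eqVneq v jr; case: (y jr) => [[|[|?]] ?] //; apply/val_inj.
have sgn y : (-1) ^+ ((flip y jr != 0) (+) a (flip y)) =
             - (-1) ^+ ((y jr != 0) (+) a y) :> C.
  rewrite /flip a_upd ffunE eqxx.
  by case: (y jr == 0); case: (a y); rewrite /= ?expr0 ?expr1 ?opprK.
set S := \sum_(y : basis (rest i)) _; have : S = - S.
  rewrite {1}/S (reindex_inj (inv_inj flipK)) -sumrN.
  by apply: eq_bigr => y _; exact: sgn.
by move/eqP; rewrite -addr_eq0 -mulr2n mulrn_eq0 => /eqP.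
Qed.

(** Since $(1 \pm 1)^2 = 2(1 \pm 1)$, the squared modulus is affine in the sign, and the sign part
    sums to zero. *)
Lemma norm_amplitude : \sum_y `|amplitude y| ^+ 2 = 1.
Proof.
transitivity (\sum_(y : basis (rest i)) 2^-1 ^+ #|{: rest i}| *
    (1 + (-1) ^+ ((y jr != 0) (+) a y)) : C).
  apply: eq_bigr => y _; rewrite /amplitude !normrM normrX normr_sign mulr1.
  rewrite (ger0_norm c_ge0) exprMn -exprM mulnC exprM c2 exprSr.
  rewrite -mulrA; congr (_ * _); case: (_ (+) _); rewrite ?expr0 ?expr1.
    by rewrite subrr normr0 expr0n !mulr0.
  by rewrite -[1 + 1]/(2%:R) normr_nat expr2 mulrA mulVf ?mul1r // pnatr_eq0.
rewrite -big_distrr big_split /= sum_sign addr0 sumr_const card_ffun card_ord.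
by rewrite natrX -exprMn mulVf ?expr1n // pnatr_eq0.
Qed.

(** The projected state has norm $1/\sqrt2$, which normalization divides out. *)
Lemma post_measurement_plusE y :
  post_measurement_plus R E i y = amplitude y.
Proof.
rewrite ffunE partial_bra_graph_state /=.
under eq_bigr do rewrite partial_bra_graph_state normrM exprMn.
rewrite -big_distrr /= norm_amplitude mulr1 sqrCK ?normr_ge0 // ger0_norm //.
exact: mulKf c_neq0 _.
Qed.

Let amplitudeE y :
  amplitude y = c ^+ #|{: rest i}|.+1 * (-1) ^+ (P y (+) ((y jr != 0) && s y)) *
    (1 + (-1) ^+ ((y jr != 0) (+) a y)).
Proof. by []. Qed.

Lemma gate_at_jr (A : 'M[C]_2) (psi : state R (rest i)) x :
  gate_at i j A psi x = \sum_b A (x jr) b * psi (upd x jr b).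
Proof.
rewrite (@tensor_op_diag_off _ _ _ jr) => [|u uj].
  rewrite big1 ?mul1r /= ?eqxx // => u uj.
  by rewrite [val u == j](negbTE uj) mxE eqxx.
by rewrite [val u == j](negbTE uj) scalar_mx_is_diag.
Qed.

Lemma gate_at_hadamard_post_measurement :
  gate_at i j (hadamard R) (post_measurement_plus R E i) = target_state R E i j.
Proof.
apply/ffunP => x; rewrite gate_at_jr target_stateE !big_ord_recl big_ord0 addr0.
rewrite !post_measurement_plusE !amplitudeE !P_upd !a_upd !s_upd.
rewrite !ffunE eqxx !mxE /=.
rewrite !exprSr; move: (c ^+ _) => cn.
(* The Hadamard gate brings a second factor $c$, and the surviving term a factor 2; $2c^2 = 1$ is
   the one fact that [ring] must be handed. *)
have key z : cn * (c * c * 2) * z = cn * z.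
  by rewrite -expr2 c2 mulVf ?mulr1 // pnatr_eq0.
case: (x jr == 0); case: (P x); case: (a x); case: (s x);
  rewrite /= ?expr0 ?expr1.
all: (rewrite -[RHS]key; ring).
Qed.

(** By independence no element of $N(i)$ is adjacent to $j$, so excluding $N(j)$ removes nothing. *)
Let S_plusE : neighbors E i :\ j = S_plus E i j.
Proof.
apply/setP => u; rewrite !inE negb_or; case uj: (u == j); rewrite ?andbF //= andbT.
case uNi: ([set i; u] \in E); rewrite ?andbF // andbT.
have uN : u \in neighbors E i by rewrite in_neighbors.
by rewrite (negbTE (forall_inP (forall_inP indNi _ jNi) _ uN)).
Qed.

Lemma correction_plus_target :
  correction_plus R E i j (target_state R E i j) = post_measurement_plus R E i.
Proof.
apply/ffunP => x; rewrite post_measurement_plusE amplitudeE.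
rewrite (@tensor_op_diag_off _ _ _ jr) => [|u uj]; last first.
  rewrite [val u == j](negbTE uj); case: ifP => _; last exact: scalar_mx_is_diag.
  apply/is_diag_mxP => r q; rewrite mxE.
  by case: r q => [[|[|?]] ?] [[|[|?]] ?].
rewrite /= eqxx rot_y_minus_pihalf.
(* Off $j$ only the $Z$-string on $A$ acts, with sign $(-1)^{A(x)}$. *)
have -> : \prod_(u | u != jr) (if val u == j then mx2 c c (- c) c
    else if val u \in S_plus E i j then pauli_z R else 1%:M) (x u) (x u) =
    (-1) ^+ a x.
  rewrite {1}/a /ext parity_extend_false S_plusE.
  rewrite (big_morph (fun b : bool => (-1 : C) ^+ b) (@signr_addb _) (erefl _)).
  rewrite big_mkcond [RHS]big_mkcond; apply: eq_bigr => u _.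
  case: eqVneq => [->|uj] /=; first by rewrite !inE eqxx orbT.
  rewrite [val u == j](negbTE uj); case: ifP => _; last by rewrite mxE eqxx.
  by rewrite mxE /bits; case: (x u == 0).
rewrite !big_ord_recl big_ord0 addr0 !target_stateE !P_upd !a_upd !s_upd.
rewrite !ffunE eqxx !mxE /=.
rewrite !exprSr; move: (c ^+ _) => cn.
case: (x jr == 0); case: (P x); case: (a x); case: (s x);
  rewrite /= ?expr0 ?expr1.
all: by ring.
Qed.

Lemma lker_correction_plus : lker (correction_plus R E i j) == 0%VS.
Proof.
(* The inverse factors are the transposed rotation, which is $R_y(\pi/2)$, at $j$, and $Z$ itself on
   $S_+$. *)
apply: (@tensor_op_lker0 _ _ _ (fun u : rest i => if val u == j then mx2 c (- c) c c
   else if val u \in S_plus E i j then pauli_z R else 1%:M)) => u.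
have mx2_1 : mx2 1 0 0 1 = 1%:M :> 'M[C]_2.
  by apply/matrixP => r q; rewrite !mxE; case: r q => [[|[|?]] ?] [[|[|?]] ?].
case: ifP => _.
  rewrite rot_y_minus_pihalf mx2M -mx2_1.
  have cc : c * c + c * c = 1.
    by rewrite -expr2 c2 -mulr2n -[LHS]mulr_natr mulVf // pnatr_eq0.
  by congr mx2; rewrite -?cc; ring.
case: ifP => _; last by rewrite mulmx1.
by rewrite mx2M -mx2_1; congr mx2; ring.
Qed.

End XMeasurementAmplitudes.

(** As operators the two differ, since $U_+^{-1} = H_j Z_{N(i)}$; the equality is therefore one of
    their actions on the post-measurement state, which $Z_{N(i)}$ fixes. *)
Theorem theorem1 (R : realType) (V : finType) (E : {set {set V}}) (i j : V)
    (graphE : is_graph E)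
    (neighbor_ij : j \in neighbors E i)
    (independent_Ni : independent E (neighbors E i)) :
  let psi := post_measurement_plus R E i in
  [/\ psi = correction_plus R E i j (target_state R E i j),
      ((correction_plus R E i j)^-1)%VF psi = gate_at i j (hadamard R) psi
    & gate_at i j (hadamard R) psi = target_state R E i j].
Proof.
have corr := correction_plus_target R graphE neighbor_ij independent_Ni.
have gate := gate_at_hadamard_post_measurement R graphE neighbor_ij independent_Ni.
(* Only the middle claim remains: writing $\psi$ as $U_+$ applied to the target reduces it to
   $U_+^{-1} U_+ = 1$. *)
split => //=; rewrite gate -[in LHS]corr lker0_lfunK //.
exact: lker_correction_plus.
Qed.
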